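(* Let $K$ be an algebraically closed field of characteristic $0$ and let $k,l,m,n\in\mathbb{Z}$ be such that the double commutator $w=[[x^k,y^l],[x^m,y^n]]$ is a non-trivial element of the free group $\mathsf{F}_2=\langle x,y\rangle$. Then the word map $\tilde w\colon \mathrm{PSL}_2(K)\times \mathrm{PSL}_2(K)\to \mathrm{PSL}_2(K)$, $(g,h)\mapsto w(g,h)$, is surjective.
   Context: $\mathsf{F}_2=\langle x,y\rangle$ is the free group on $x,y$. The commutator convention is $[a,b]=a^{-1}b^{-1}ab$. For a word $w\in\mathsf{F}_2$ and a group $G$, $w(g,h)$ denotes the image of $w$ under the homomorphism $\mathsf{F}_2\to G$ sending $x\mapsto g$, $y\mapsto h$. *)

(* Defs.v *)
From HB Require Import structures.
From mathcomp Require Import all_boot all_order all_algebra all_fingroup.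
From mathcomp Require Import generic_quotient.

Set Implicit Arguments.
Unset Strict Implicit.
Unset Printing Implicit Defensive.

Import GRing.Theory.
Local Open Scope group_scope.

Definition expgz (G : groupType) (x : G) (k : int) : G :=
  match k with Posz n => x ^+ n | Negz n => x ^- n.+1 end.

Section FreeGroup.
Variable T : choiceType.

(* (t, true) stands for t and (t, false) for its inverse. *)
Definition letter := (T * bool)%type.
Implicit Types (a b : letter) (s t u : seq letter).

Definition oppl a : letter := (a.1, ~~ a.2).

Definition reduced s := sorted (fun a b => b != oppl a) s.
Arguments reduced : simpl never.

Definition pushl a s :=
  if s is b :: s' then if b == oppl a then s' else a :: s else [:: a].

Definition catl s t := foldr pushl t s.

Definition invl s := rev (map oppl s).

Lemma opplK : involutive oppl.
Proof. by case=> t e; rewrite /oppl /= negbK. Qed.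

Lemma reduced_cons a s :
  reduced (a :: s) = (if s is b :: _ then b != oppl a else true) && reduced s.
Proof. by case: s. Qed.

Lemma pushl_reduced a s : reduced s -> reduced (pushl a s).
Proof.
case: s => [|b s] // rs; rewrite /pushl; case: ifP => [_|ab].
  by move: rs; rewrite reduced_cons => /andP[].
by rewrite reduced_cons ab.
Qed.

Lemma pushlK a s : reduced s -> pushl (oppl a) (pushl a s) = s.
Proof.
case: s => [|b s] rs; first by rewrite /= opplK eqxx.
rewrite {2}/pushl; case: ifP => [/eqP ab|ab]; last by rewrite /= opplK eqxx.
move: rs; rewrite ab reduced_cons; case: s => // c s /andP[cb _].
by rewrite /= (negPf cb).
Qed.

Lemma catl_reduced s t : reduced t -> reduced (catl s t).
Proof. by move=> rt; elim: s => //= a s; apply: pushl_reduced. Qed.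

Lemma catl_push a s t : reduced t -> catl (pushl a s) t = pushl a (catl s t).
Proof.
move=> rt; case: s => [|b s] //=; case: ifP => // /eqP -> /=.
have := @pushlK (oppl a) (catl s t); rewrite opplK => -> //.
exact: catl_reduced.
Qed.

Lemma catlA s t u : reduced u -> catl s (catl t u) = catl (catl s t) u.
Proof. by move=> ru; elim: s => //= a s ->; rewrite catl_push. Qed.

Lemma catls0 s : reduced s -> catl s [::] = s.
Proof.
elim: s => //= a s IH; rewrite reduced_cons => /andP[ha rs]; rewrite IH //.
by case: s ha {IH rs} => //= b s /negPf ->.
Qed.

Lemma invlK : involutive invl.
Proof.
by move=> s; rewrite /invl map_rev revK -map_comp map_id_in // => a _ /=;
   rewrite opplK.
Qed.

Lemma invl_reduced s : reduced s -> reduced (invl s).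
Proof.
rewrite /reduced /invl rev_sorted sorted_map; apply: sub_sorted => a b /=.
by rewrite opplK eq_sym.
Qed.

Lemma catVl s : catl (invl s) s = [::].
Proof.
elim: s => // a s IH; rewrite /invl /= rev_cons /catl foldr_rcons /=.
by rewrite opplK eqxx.
Qed.

(* The free group on T, realised by reduced words. *)
Record free_group := FreeGroup { fgval :> seq letter; _ : reduced fgval }.

HB.instance Definition _ := [isSub for fgval].
HB.instance Definition _ := [Choice of free_group by <:].

Lemma fgP (w : free_group) : reduced w. Proof. exact: valP w. Qed.

Definition fg_one : free_group := @FreeGroup [::] isT.
Definition fg_mul (v w : free_group) : free_group :=
  FreeGroup (catl_reduced v (fgP w)).
Definition fg_inv (w : free_group) : free_group := FreeGroup (invl_reduced (fgP w)).

Lemma fg_mulA : associative fg_mul.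
Proof. by move=> u v w; apply/val_inj/catlA/fgP. Qed.
Lemma fg_mul1 : left_id fg_one fg_mul.
Proof. by move=> w; apply/val_inj. Qed.
Lemma fg_mulr1 : right_id fg_one fg_mul.
Proof. by move=> w; apply/val_inj/catls0/fgP. Qed.
Lemma fg_mulV : left_inverse fg_one fg_inv fg_mul.
Proof. by move=> w; apply/val_inj/catVl. Qed.
Lemma fg_mulrV : right_inverse fg_one fg_inv fg_mul.
Proof. by move=> w; apply/val_inj; rewrite /= -{1}[fgval w]invlK catVl. Qed.

HB.instance Definition _ :=
  isGroup.Build free_group fg_mulA fg_mul1 fg_mulr1 fg_mulV fg_mulrV.

Definition fg_gen (t : T) : free_group := @FreeGroup [:: (t, true)] isT.

Section Eval.
Variables (G : groupType) (f : T -> G).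

Definition evall (a : letter) : G := if a.2 then f a.1 else (f a.1)^-1.

(* The homomorphism to G extending f. *)
Definition fg_eval (w : free_group) : G := foldr (fun a x => evall a * x) 1 w.

Lemma evall_opp a : evall (oppl a) = (evall a)^-1.
Proof. by case: a => t [] //=; rewrite /evall /= invgK. Qed.

Lemma fg_evalM : {morph fg_eval : u v / u * v}.
Proof.
move=> u v; rewrite /fg_eval /= /catl; elim: (fgval u) => /= [|a s IH].
  by rewrite mul1g.
rewrite -mulgA -IH; case: (foldr pushl _ _) => [|b t] //=.
by case: ifP => // /eqP -> /=; rewrite evall_opp mulgA mulgV mul1g.
Qed.

HB.instance Definition _ := isMultiplicative.Build free_group G fg_eval fg_evalM.
HB.instance Definition _ :=
  Multiplicative_isUMagmaMorphism.Build free_group G fg_eval erefl.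

Lemma fg_eval_gen (t : T) : fg_eval (fg_gen t) = f t.
Proof. exact: mulg1. Qed.

Lemma fg_eval_unique (phi : free_group -> G) :
    {morph phi : u v / u * v} -> (forall t : T, phi (fg_gen t) = f t) ->
  phi =1 fg_eval.
Proof.
move=> phiM phi_gen.
have phi1 : phi 1 = 1 by apply: (mulgI (phi 1)); rewrite -phiM !mulg1.
have phiV (t : T) : phi (fg_gen t)^-1 = (f t)^-1.
  by apply: (mulgI (f t)); rewrite -{1}phi_gen -phiM !mulgV.
case=> s; elim: s => [|a s IH] rs.
  by rewrite -[RHS]phi1; congr phi; apply: val_inj.
have rs' : reduced s by move: rs; rewrite reduced_cons => /andP[].
have ra : reduced [:: a] by [].
have -> : FreeGroup rs = FreeGroup ra * FreeGroup rs'.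
  apply: val_inj => /=; move: rs; rewrite reduced_cons.
  by case: (s) => //= b s' /andP[/negPf->].
rewrite phiM IH fg_evalM; congr (_ * _); case: a {rs} ra => t [] ra.
  have -> : FreeGroup ra = fg_gen t by apply: val_inj.
  by rewrite phi_gen fg_eval_gen.
have -> : FreeGroup ra = (fg_gen t)^-1 by apply: val_inj.
by rewrite phiV /fg_eval /= mulg1.
Qed.

End Eval.
End FreeGroup.

Definition F2 := free_group bool.
HB.instance Definition _ := Group.on F2.

Definition genx : F2 := fg_gen false.
Definition geny : F2 := fg_gen true.

Definition word_map (w : F2) (G : groupType) (gh : G * G) : G :=
  fg_eval (fun b : bool => if b then gh.2 else gh.1) w.

(* [~ a, b] unfolds to a^-1 * (b^-1 * (a * b)). *)
Definition double_commutator (k l m n : int) : F2 :=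
  [~ [~ expgz genx k, expgz geny l], [~ expgz genx m, expgz geny n]].

Section PSL2.
Local Open Scope quotient_scope.
Local Open Scope ring_scope.
Variable K : fieldType.

Record SL2 := MkSL2 { SL2val :> 'M[K]_2; _ : \det SL2val == 1 }.

HB.instance Definition _ := [isSub for SL2val].
HB.instance Definition _ := [Choice of SL2 by <:].

Lemma SL2_det (A : SL2) : \det A = 1. Proof. exact/eqP/(valP A). Qed.
Lemma SL2_unit (A : SL2) : (A : 'M_2) \in unitmx.
Proof. by rewrite unitmxE SL2_det unitr1. Qed.

Fact SL2_one_proof : \det (1%:M : 'M[K]_2) == 1. Proof. by rewrite det1. Qed.
Fact SL2_mul_proof (A B : SL2) : \det (A *m B) == 1.
Proof. by rewrite det_mulmx !SL2_det mulr1. Qed.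
Fact SL2_inv_proof (A : SL2) : \det (invmx A) == 1.
Proof. by rewrite det_inv SL2_det invr1. Qed.

Definition SL2_one := MkSL2 SL2_one_proof.
Definition SL2_mul A B := MkSL2 (SL2_mul_proof A B).
Definition SL2_inv A := MkSL2 (SL2_inv_proof A).

Lemma SL2_mulA : associative SL2_mul.
Proof. by move=> A B C; apply/val_inj/mulmxA. Qed.
Lemma SL2_mul1 : left_id SL2_one SL2_mul.
Proof. by move=> A; apply/val_inj/mul1mx. Qed.
Lemma SL2_mulr1 : right_id SL2_one SL2_mul.
Proof. by move=> A; apply/val_inj/mulmx1. Qed.
Lemma SL2_mulV : left_inverse SL2_one SL2_inv SL2_mul.
Proof. by move=> A; apply/val_inj/mulVmx/SL2_unit. Qed.
Lemma SL2_mulrV : right_inverse SL2_one SL2_inv SL2_mul.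
Proof. by move=> A; apply/val_inj/mulmxV/SL2_unit. Qed.

HB.instance Definition _ :=
  isGroup.Build SL2 SL2_mulA SL2_mul1 SL2_mulr1 SL2_mulV SL2_mulrV.

Definition PSL2_eq (A B : SL2) : bool :=
  ((A : 'M_2) == B) || ((A : 'M_2) == - (B : 'M_2)).

Lemma PSL2_eqP (A B : SL2) :
  reflect (exists b : bool, (A : 'M_2) = (-1) ^+ b *: (B : 'M_2))
          (PSL2_eq A B).
Proof.
apply: (iffP orP) => [[/eqP->|/eqP->]|[[] ->]].
- by exists false; rewrite expr0 scale1r.
- by exists true; rewrite expr1 scaleN1r.
- by right; rewrite expr1 scaleN1r.
- by left; rewrite expr0 scale1r.
Qed.

Lemma PSL2_eq_refl : reflexive PSL2_eq.
Proof. by move=> A; rewrite /PSL2_eq eqxx. Qed.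
Lemma PSL2_eq_sym : symmetric PSL2_eq.
Proof. by move=> A B; rewrite /PSL2_eq eq_sym -eqr_oppLR [X in _ || X]eq_sym. Qed.
Lemma PSL2_eq_trans : transitive PSL2_eq.
Proof.
move=> B A C /PSL2_eqP[a Aa] /PSL2_eqP[b Bb]; apply/PSL2_eqP.
by exists (a (+) b); rewrite Aa Bb scalerA signr_addb.
Qed.

Canonical PSL2_equiv := EquivRel PSL2_eq PSL2_eq_refl PSL2_eq_sym PSL2_eq_trans.

(* SL_2(K) modulo its center {I, -I}. *)
Definition PSL2 := {eq_quot PSL2_equiv}.
HB.instance Definition _ := Choice.on PSL2.
HB.instance Definition _ := EqQuotient.on PSL2.

Definition PSL2_one : PSL2 := \pi_PSL2 1%g.
Definition PSL2_mul (x y : PSL2) : PSL2 := \pi_PSL2 (repr x * repr y)%g.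
Definition PSL2_inv (x : PSL2) : PSL2 := \pi_PSL2 (repr x)^-1%g.

Lemma PSL2_repr (A : SL2) : exists b : bool,
  (repr (\pi_PSL2 A) : 'M_2) = (-1) ^+ b *: (A : 'M_2).
Proof. by apply/PSL2_eqP; rewrite -(eqmodE PSL2_equiv) reprK. Qed.

Lemma PSL2_pi A B : PSL2_eq A B -> \pi_PSL2 A = \pi_PSL2 B.
Proof. by move=> AB; apply/eqmodP. Qed.

Lemma PSL2_piM A B : \pi_PSL2 (A * B)%g = PSL2_mul (\pi_PSL2 A) (\pi_PSL2 B).
Proof.
apply/esym/PSL2_pi/PSL2_eqP.
have [a Aa] := PSL2_repr A; have [b Bb] := PSL2_repr B.
exists (a (+) b); rewrite /= Aa Bb signr_addb.
by rewrite -scalemxAl -scalemxAr scalerA.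
Qed.

Lemma PSL2_mulA : associative PSL2_mul.
Proof.
move=> x y z; rewrite -[x]reprK -[y]reprK -[z]reprK.
rewrite -(PSL2_piM (repr y)) -(PSL2_piM (repr x) (repr y)).
by rewrite -!PSL2_piM mulgA.
Qed.
Lemma PSL2_mul1 : left_id PSL2_one PSL2_mul.
Proof. by move=> x; rewrite -[x]reprK -PSL2_piM mul1g. Qed.
Lemma PSL2_mulr1 : right_id PSL2_one PSL2_mul.
Proof. by move=> x; rewrite -[x]reprK -PSL2_piM mulg1. Qed.
Lemma PSL2_mulV : left_inverse PSL2_one PSL2_inv PSL2_mul.
Proof. by move=> x; rewrite -{2}[x]reprK -PSL2_piM mulVg. Qed.
Lemma PSL2_mulrV : right_inverse PSL2_one PSL2_inv PSL2_mul.
Proof. by move=> x; rewrite -{1}[x]reprK -PSL2_piM mulgV. Qed.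

HB.instance Definition _ :=
  isGroup.Build PSL2 PSL2_mulA PSL2_mul1 PSL2_mulr1 PSL2_mulV PSL2_mulrV.
HB.instance Definition _ :=
  isMultiplicative.Build SL2 PSL2 \pi_PSL2 PSL2_piM.

End PSL2.

(* Main.v *)
Require Import Defs.
From mathcomp Require Import all_boot all_order all_algebra.
From HB Require Import structures.
From mathcomp Require Import generic_quotient ring.

(** Two elements of SL_2(K) that are not scalar and have the same trace are
    conjugate ([SL2_conj]), and the set of values of a word is closed under
    conjugation.  So it suffices to find, for each t in K, a value of
    w = [[x^k, y^l], [x^m, y^n]] on SL_2(K) with trace t that is not the
    identity; the trace -2 is avoided by passing to the opposite matrix, which
    has the same image in PSL_2(K).  Trace 2 is the only delicate case, because
    the identity has trace 2 as well.

    If w is not trivial, then k, l, m, n are nonzero and (k, l) <> (m, n)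
    ([dcomm_neq1]).  Exchanging x and y conjugates the values of w
    ([dcomm_swap]), so one may assume l <> n.  Everything is then found in the
    family g = [1 1; 0 1], h = [b 0; z (b - 1/b), 1/b], where b is not a root of
    unity and z is a parameter.  Write B = b^l and N = b^n, and let
    A1 = [g^k, h^l] and A2 = [g^m, h^n].

    The key fact ([commUL_bracket]) is the factorization
      A1 A2 - A2 A1 = k m (B - 1/B) (N - 1/N) Z E Z,
      E = g^k h^l g^-m h^-n - g^m h^n g^-k h^-l,
    where Z = [z -1; 0 -z] is a multiple of g h - h g.  It comes from two
    remarks.  Since g^k and h^l are affine functions of g and h, the matrix
    A1 - 1 = g^-k h^-l (g^k h^l - h^l g^k) is a multiple of g^-k h^-l Z, and
    similarly for A2.  And Z anticommutes with the traceless parts of g and h,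
    so that moving Z across a power of g or h inverts that power.

    As 2 - tr [A1, A2] = det (A1 A2 - A2 A1) in SL_2 ([tr_SL2_commutator]), the
    trace of w(g, h) is 2 - c z^4 f(z), where c is a nonzero constant and
    f = det E is a polynomial in z ([defect_det]).  Its constant term
    - (B/N - N/B)^2 does not vanish because l <> n, and f is not constant
    ([defect_poly_nonconst]).  Hence tr w(g, h) takes every value t
    ([dcomm_trace]), and f has a root z <> 0.  At such a root w(g, h) has
    trace 2, and it differs from 1 as soon as E <> 0.

    A linear combination of two entries of E shows that E <> 0 unless
    m (B - 1/B) (N + 1/N) = k (N - 1/N) (B + 1/B).  If this equation holds both
    for b and for b^2, then m = - k and n = - l ([not_generic_exponents]).  In
    that last case E = u (P - P') with P = g^k h^l, P' = g^-k h^-l and u = tr P,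
    and the explicit root z of det (P - P') satisfies u <> 0 and P <> P',
    for b or for b^2 ([defect_special]). *)

Set Implicit Arguments.
Unset Strict Implicit.
Unset Printing Implicit Defensive.

Import GRing.Theory.
Local Open Scope ring_scope.

(** * Double commutators in a group *)

Section Words.
Local Open Scope group_scope.
Implicit Types (G : groupType) (k l m n : int).

Definition dcomm G k l m n (g h : G) : G :=
  [~ [~ expgz g k, expgz h l], [~ expgz g m, expgz h n]].

Lemma expgz_morph G (H : groupType) (f : UMagmaMorphism.type G H) (x : G) k :
  f (expgz x k) = expgz (f x) k.
Proof. by case: k => i; rewrite /expgz ?gmulfXVn ?gmulfXn. Qed.

Lemma dcomm_morph G (H : groupType) (f : UMagmaMorphism.type G H)
    k l m n (g h : G) :
  f (dcomm k l m n g h) = dcomm k l m n (f g) (f h).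
Proof. by rewrite /dcomm !gmulfR !expgz_morph. Qed.

Lemma word_map_dcomm G k l m n (g h : G) :
  word_map (double_commutator k l m n) (g, h) = dcomm k l m n g h.
Proof.
by rewrite /word_map [LHS]dcomm_morph; congr (dcomm k l m n);
   apply: fg_eval_gen.
Qed.

Lemma expgz_conj G (x y : G) k : expgz (x ^ y) k = expgz x k ^ y.
Proof. by case: k => i; rewrite /expgz ?conjVg conjXg. Qed.

Lemma dcomm_conj G k l m n (g h x : G) :
  dcomm k l m n (g ^ x) (h ^ x) = dcomm k l m n g h ^ x.
Proof. by rewrite /dcomm !expgz_conj !conjRg. Qed.

(** Exchanging the variables inverts both inner commutators, and
    [a^-1, b^-1] is conjugate to [a, b]. *)
Lemma dcomm_swap G k l m n (g h : G) :
  exists x, dcomm k l m n g h = dcomm l k n m h g ^ x.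
Proof.
rewrite /dcomm -[[~ expgz h l, _]]invgR -[[~ expgz h n, _]]invgR.
set a := [~ expgz g k, _]; set b := [~ expgz g m, _].
exists (b * a).
by rewrite conjgE /commg /conjg !invgK !invgM !mulgA !mulgVK.
Qed.

Lemma dcomm_neq1 k l m n : double_commutator k l m n != 1 ->
  [/\ k != 0, l != 0, m != 0, n != 0 & (k != m) || (l != n)]%R.
Proof.
rewrite /double_commutator => w1.
have expgz0 G (x : G) : expgz x 0%R = 1 by [].
split; apply: contra_neqT w1; rewrite ?negb_or !negbK.
- by move/eqP->; rewrite expgz0 !comm1g.
- by move/eqP->; rewrite expgz0 commg1 comm1g.
- by move/eqP->; rewrite expgz0 comm1g commg1.
- by move/eqP->; rewrite expgz0 !commg1.
- by move=> /andP[/eqP-> /eqP->]; rewrite commgg.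
Qed.

End Words.

(** * Two-by-two matrices *)

Section Mx2.
Variable R : comNzRingType.
Implicit Types a b c d : R.

Definition mx2 a b c d : 'M[R]_2 :=
  \matrix_(i, j) (if i == 0 then if j == 0 then a else b
                  else if j == 0 then c else d).

Lemma eq_mx2 (A B : 'M[R]_2) : A 0 0 = B 0 0 -> A 0 1 = B 0 1 ->
  A 1 0 = B 1 0 -> A 1 1 = B 1 1 -> A = B.
Proof.
move=> e00 e01 e10 e11; apply/matrixP => i j.
have ord2 (x : 'I_2) : x = 0 \/ x = 1.
  by case: x => [[|[|//]] lt2]; [left | right]; apply: val_inj.
by case: (ord2 i) (ord2 j) => -> [->|->].
Qed.

Lemma mx2_eta (A : 'M[R]_2) : A = mx2 (A 0 0) (A 0 1) (A 1 0) (A 1 1).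
Proof. by apply: eq_mx2; rewrite !mxE. Qed.

Lemma mx2_mul a b c d a' b' c' d' : mx2 a b c d *m mx2 a' b' c' d' =
  mx2 (a * a' + b * c') (a * b' + b * d') (c * a' + d * c') (c * b' + d * d').
Proof. by apply: eq_mx2; rewrite !mxE !big_ord_recl big_ord0 !mxE /= addr0. Qed.

Lemma mx2_sub a b c d a' b' c' d' : mx2 a b c d - mx2 a' b' c' d' =
  mx2 (a - a') (b - b') (c - c') (d - d').
Proof. by apply: eq_mx2; rewrite !mxE. Qed.

Lemma mx2_scale x a b c d :
  x *: mx2 a b c d = mx2 (x * a) (x * b) (x * c) (x * d).
Proof. by apply: eq_mx2; rewrite !mxE. Qed.

Lemma mx2_scalar x : x%:M = mx2 x 0 0 x.
Proof. by apply: eq_mx2; rewrite !mxE. Qed.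

Lemma mx2_det a b c d : \det (mx2 a b c d) = a * d - b * c.
Proof.
rewrite (expand_det_row _ 0) !big_ord_recl big_ord0 /cofactor !det_mx11.
by rewrite !mxE /= /bump /= expr1 expr0 mul1r mulN1r mulrN addr0.
Qed.

Lemma mx2_tr a b c d : \tr (mx2 a b c d) = a + d.
Proof. by rewrite /mxtrace !big_ord_recl big_ord0 !mxE addr0. Qed.

End Mx2.

(** * Conjugacy, traces and powers in SL_2 *)

Section Conjugacy.
Variable K : closedFieldType.
Implicit Types A B C : SL2 K.

Lemma closed_field_sqrt (a : K) : exists x, x ^+ 2 = a.
Proof.
have : size ('X^2 - a%:P : {poly K}) != 1 by rewrite size_XnsubC.
by case/closed_rootP => x; rewrite rootE !hornerE subr_eq0 => /eqP; exists x.
Qed.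

(** A nonscalar matrix A has a row vector v with v and v A independent; in the
    basis (v, v A) it becomes the companion matrix of its characteristic
    polynomial.  A square root rescales v so that the base change has
    determinant 1. *)
Lemma SL2_companion A : ~~ is_scalar_mx A ->
  exists C : SL2 K, val C *m A = mx2 0 1 (-1) (\tr A) *m val C.
Proof.
move=> nscal; have := SL2_det A; move: nscal.
rewrite [val A : 'M_2]mx2_eta; move: (A 0 0) (A 0 1) (A 1 0) (A 1 1) => a b c d.
rewrite mx2_det mx2_tr => nscal /eqP; rewrite subr_eq => /eqP detA.
(* The quadratic form in (p, q) is the determinant of the rows v, v A for
   v = (p, q); one of (1, 0), (0, 1), (1, 1) makes it nonzero. *)
have [p [q D0]] : exists p q, p ^+ 2 * b + p * q * (d - a) - q ^+ 2 * c != 0.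
  have [b0|b0] := eqVneq b 0; last first.
    by exists 1, 0;
       rewrite !(expr1n, expr0n, mul0r, mulr0, mul1r, subr0, addr0).
  have [c0|c0] := eqVneq c 0; last first.
    exists 0, 1.
    by rewrite !(expr1n, expr0n, mul0r, mulr0, mul1r, sub0r, addr0, oppr_eq0).
  exists 1, 1; rewrite b0 c0 !(expr1n, mulr0, mul1r, subr0, add0r) subr_eq0.
  apply: contraNneq nscal => ->; apply/is_scalar_mxP; exists a.
  by rewrite b0 c0 mx2_scalar.
have [s sE] :=
  closed_field_sqrt (p ^+ 2 * b + p * q * (d - a) - q ^+ 2 * c)^-1.
have detC :
    \det (mx2 (s * p) (s * q) (s * (p * a + q * c)) (s * (p * b + q * d))) == 1.
  rewrite mx2_det; apply/eqP.
  transitivity (s ^+ 2 * (p ^+ 2 * b + p * q * (d - a) - q ^+ 2 * c)).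
    by ring.
  by rewrite sE mulVf.
by exists (MkSL2 detC) => //=; rewrite !mx2_mul; congr mx2; ring: detA.
Qed.

Lemma SL2_conj A B : ~~ is_scalar_mx A -> ~~ is_scalar_mx B ->
  \tr A = \tr B -> exists C, (A ^ C)%g = B.
Proof.
move=> /SL2_companion[C CA] /SL2_companion[D DB] trAB.
have det_comp : \det (mx2 0 1 (-1) (\tr A)) == 1.
  by rewrite mx2_det; apply/eqP; ring.
pose T : SL2 K := MkSL2 det_comp.
have CAT : (C * A = T * C)%g by apply: val_inj.
have DBT : (D * B = T * D)%g by apply: val_inj; rewrite /= DB -trAB.
exists (C^-1 * D)%g; apply: (mulgI D).
by rewrite conjgE invgM invgK DBT !mulgA mulgV mul1g CAT mulgK.
Qed.

End Conjugacy.

Section Trace.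
Variable K : fieldType.
Implicit Types A B : SL2 K.

(** For W in SL_2, det (W - 1) = 2 - tr W; take W = [A, B] and multiply on the
    left by B A. *)
Lemma tr_SL2_commutator A B :
  \tr (val [~ A, B]%g) = 2 - \det (val A *m val B - val B *m val A).
Proof.
set W := [~ A, B]%g.
have -> : val A *m val B = val B *m val A *m val W.
  by have /(congr1 val) := commgC A B.
rewrite -{2}[val B *m val A]mulmx1 -mulmxBr !det_mulmx !SL2_det !mul1r.
have : \det (val W) = 1 := SL2_det W.
move: (val W) => w; rewrite [w]mx2_eta mx2_scalar mx2_sub !mx2_det mx2_tr.
by move=> /eqP; rewrite subr_eq => /eqP detW; ring: detW.
Qed.

Lemma scalar_SL2_tr A : is_scalar_mx A -> \tr A = 2 \/ \tr A = - 2.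
Proof.
case/is_scalar_mxP => x Ax; have := SL2_det A.
rewrite Ax det_scalar mxtrace_scalar.
move/eqP; rewrite sqrf_eq1 => /orP[]/eqP->; [by left | right].
by rewrite mulNrn.
Qed.

Lemma val_expgz A (phi : int -> 'M[K]_2) i :
    phi 0 = 1%:M -> (forall u v, phi (u + v) = phi u *m phi v) ->
  phi 1 = A -> val (expgz A i) = phi i.
Proof.
move=> phi0 phiD phi1.
have phiX n : val (A ^+ n)%g = phi n.
  elim: n => [|n IH]; first by rewrite phi0.
  by rewrite expgS /= IH intS phiD phi1.
case: i => n; first exact: phiX.
rewrite /expgz NegzE.
set C : SL2 K := (A ^+ n.+1)%g.
have CV : val C *m phi (- n.+1%:Z) = 1%:M by rewrite phiX -phiD subrr.
by rewrite -[RHS](mulKmx (SL2_unit C)) CV mulmx1.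
Qed.

End Trace.

(** * A family of pairs of matrices *)

Section Family.
Variable K : fieldType.
Implicit Types k m z B N : K.

(** The factor B - 1/B in the corner makes [lower z] multiplicative in B:
    for a given z, all these matrices have the same two eigenlines. *)
Definition upper k : 'M[K]_2 := mx2 1 k 0 1.
Definition lower z B : 'M[K]_2 := mx2 B 0 (z * (B - B^-1)) B^-1.

(** The commutator of [upper k] and [lower z B], with the inverses written out
    as members of the same families. *)
Definition commUL z k B :=
  upper (- k) *m (lower z B^-1 *m (upper k *m lower z B)).

Lemma upper_expgz (g : SL2 K) i :
  val g = upper 1 -> val (expgz g i) = upper i%:~R.
Proof.
move=> g1.
apply: (@val_expgz _ _ (fun i : int => upper i%:~R)) => [|u v|].
- by rewrite /upper mx2_scalar.
- by rewrite mx2_mul intrD; congr mx2; ring.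
- by rewrite g1.
Qed.

Lemma lower_expgz (h : SL2 K) z b i : b != 0 -> val h = lower z b ->
  val (expgz h i) = lower z (b ^ i).
Proof.
move=> b0 h1; apply: (@val_expgz _ _ (fun i : int => lower z (b ^ i))) => [|u v|].
- by rewrite /lower expr0z invr1 subrr mulr0 mx2_scalar.
- have [bu bv] : b ^ u != 0 /\ b ^ v != 0 by rewrite !expfz_neq0.
  by rewrite mx2_mul expfzDr //; congr mx2; field; rewrite ?bu ?bv.
- by rewrite h1 expr1z.
Qed.

Lemma commUL_expgz (g h : SL2 K) z b i j :
    b != 0 -> val g = upper 1 -> val h = lower z b ->
  val [~ expgz g i, expgz h j]%g = commUL z i%:~R (b ^ j).
Proof.
move=> b0 gE hE.
have expgzV (x : SL2 K) u : ((expgz x u)^-1 = expgz x (- u))%g.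
  by case: u => [[|u]|u]; rewrite /expgz ?expg0 ?invg1 ?invgK // NegzE opprK.
rewrite /commg /conjg !expgzV /= !(upper_expgz _ gE) !(lower_expgz _ b0 hE).
by rewrite /commUL mulrNz invr_expz.
Qed.

(** The matrix E of the factorization, with [upper k], [upper m], [lower z B] and
    [lower z N] standing for g^k, g^m, h^l and h^n. *)
Definition defect z k m B N :=
  upper k *m lower z B *m upper (- m) *m lower z N^-1
  - upper m *m lower z N *m upper (- k) *m lower z B^-1.

(** Write the two commutators as 1 + c U Z and 1 + c' V Z with U = g^-k h^-l and
    V = g^-m h^-n.  Their bracket is c c' (U Z V - V Z U) Z, and moving Z to the
    left of U and of V inverts the powers in U and V, which gives c c' Z E Z.
    Here Z = [z -1; 0 -z] is half the bracket of [upper 1] with [1 0; 2z -1],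
    the traceless direction of every [lower z B]. *)
Lemma commUL_bracket z k m B N : B != 0 -> N != 0 ->
  commUL z k B *m commUL z m N - commUL z m N *m commUL z k B
  = (k * m * (B - B^-1) * (N - N^-1)) *:
      (mx2 z (-1) 0 (-z) *m defect z k m B N *m mx2 z (-1) 0 (-z)).
Proof.
move=> B0 N0.
rewrite /defect /commUL /upper /lower !mx2_mul !mx2_sub !mx2_mul mx2_scale.
by congr mx2; field; rewrite B0 N0 oner_eq0.
Qed.

(** The coefficients, in powers of z, of the entries of [defect z k m B N],
    which is traceless: see [defectE]. *)
Section Coefficients.
Variables k m B N : K.
Definition diag0 := B / N - N / B.
Definition diag1 := m * N * (B - B^-1) - k * B * (N - N^-1).
Definition up0 := k * N * (B + B^-1) - m * B * (N + N^-1).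
Definition up1 := - (k * m * diag0).
Definition low2 := (m - k) * (B - B^-1) * (N - N^-1).

Definition defect_poly : {poly K} :=
  - ((diag0%:P + diag1%:P * 'X) ^+ 2
     + (up0%:P + up1%:P * 'X) * 'X * ((2 * diag0)%:P + low2%:P * 'X)).

Definition generic :=
  m * (B - B^-1) * (N + N^-1) != k * (N - N^-1) * (B + B^-1).
End Coefficients.

Lemma defectE z k m B N : B != 0 -> N != 0 ->
  defect z k m B N =
    mx2 (diag0 B N + diag1 k m B N * z) (up0 k m B N + up1 k m B N * z)
        (z * (2 * diag0 B N + low2 k m B N * z))
        (- (diag0 B N + diag1 k m B N * z)).
Proof.
move=> B0 N0; rewrite /defect /upper /lower !mx2_mul mx2_sub.
rewrite /up1 /diag0 /diag1 /up0 /low2.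
by congr mx2; field; rewrite ?oner_eq0 ?B0 ?N0.
Qed.

Lemma defect_det z k m B N : B != 0 -> N != 0 ->
  \det (defect z k m B N) = (defect_poly k m B N).[z].
Proof.
by move=> B0 N0; rewrite defectE // mx2_det /defect_poly !hornerE /=; ring.
Qed.

Lemma subV_eq0 B : B != 0 -> (B - B^-1 == 0) = (B ^+ 2 == 1).
Proof.
by move=> B0; rewrite -(inj_eq (mulfI B0)) mulr0 mulrBr mulfV // subr_eq0 expr2.
Qed.

(** The coefficient of degree 3 is a nonzero multiple of k - m, and if k = m
    then the coefficient of degree 2 is the square of k [diag0]. *)
Lemma defect_poly_nonconst k m B N : k != 0 -> m != 0 -> diag0 B N != 0 ->
    B - B^-1 != 0 -> N - N^-1 != 0 -> B != 0 -> N != 0 ->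
  (1 < size (defect_poly k m B N))%N.
Proof.
move=> k0 m0 d0 sB sN B0 N0; rewrite ltnNge; apply/negP => /leq_sizeP fi.
have up1_neq0 : up1 k m B N != 0 by rewrite oppr_eq0 !mulf_neq0.
have fE : defect_poly k m B N = - ((diag0 B N ^+ 2)%:P
    + (2 * diag0 B N * (diag1 k m B N + up0 k m B N)) *: 'X
    + (diag1 k m B N ^+ 2 + 2 * diag0 B N * up1 k m B N
       + up0 k m B N * low2 k m B N) *: 'X^2
    + (up1 k m B N * low2 k m B N) *: 'X^3).
  by rewrite /defect_poly -!mul_polyC; ring.
have /eqP : (defect_poly k m B N)`_3 = 0 by apply: fi.
rewrite fE !coefE /= !mulr0 !add0r mulr1 oppr_eq0 mulf_eq0 (negPf up1_neq0) /=.
rewrite !mulf_eq0 (negPf sB) (negPf sN) !orbF subr_eq0 => /eqP mk.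
have /eqP : (defect_poly k m B N)`_2 = 0 by apply: fi.
rewrite fE !coefE /= !mulr0 !add0r !addr0 mulr1 oppr_eq0 mk.
have -> : diag1 k k B N ^+ 2 + 2 * diag0 B N * up1 k k B N
    + up0 k k B N * low2 k k B N = - (k * diag0 B N) ^+ 2.
  by rewrite /diag1 /up1 /low2 /diag0; field; rewrite B0 N0.
by rewrite oppr_eq0 expf_eq0 mulf_eq0 (negPf k0) (negPf d0).
Qed.

(** If E = [defect z k m B N], then 2 z E_11 - E_21 is z^2 times the
    difference of the two sides of [generic]. *)
Lemma defect_generic k m B N z : B != 0 -> N != 0 -> z != 0 ->
  generic k m B N -> defect z k m B N != 0.
Proof.
move=> B0 N0 z0 gen; rewrite defectE //; apply: contraNneq gen => E0.
have := congr1 (fun M : 'M_2 => M 0 0) E0; rewrite !mxE /= => E00.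
have /eqP := congr1 (fun M : 'M_2 => M 1 0) E0.
rewrite !mxE /= mulf_eq0 (negPf z0) /= => /eqP E10.
rewrite -subr_eq0 -[_ == 0]orFb -(negPf z0) -mulf_eq0.
have -> : 0 = 2 * (diag0 B N + diag1 k m B N * z)
              - (2 * diag0 B N + low2 k m B N * z).
  by rewrite E00 E10; ring.
by apply/eqP; rewrite /diag1 /low2; field; rewrite B0 N0.
Qed.

(** Here E = P^2 - P'^2 with P = g^k h^l and P' = g^-k h^-l, two matrices of the
    same trace u, so E = u (P - P') by Cayley-Hamilton.  The determinant of
    P - P' is affine in z up to the factor B - 1/B, and z below is its root;
    there u is a multiple of (B + 1/B)^2 + 4. *)
Lemma defect_special k B : k != 0 -> B != 0 -> 2 != 0 :> K ->
    B - B^-1 != 0 -> B + B^-1 != 0 -> (B + B^-1) ^+ 2 + 4 != 0 ->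
  let z : K := - (B - B^-1) / (2 * k * (B + B^-1)) in
  [/\ z != 0, (defect_poly k (- k) B B^-1).[z] = 0
    & defect z k (- k) B B^-1 != 0].
Proof.
move=> k0 B0 two0 s0 t0 u0 z.
have t0' : B * B + 1 != 0.
  apply: contraNneq t0 => E.
  by rewrite -(inj_eq (mulfI B0)) mulr0 mulrDr mulfV ?E.
split.
- by rewrite mulf_neq0 ?oppr_eq0 ?invr_eq0 ?mulf_neq0.
- rewrite /defect_poly !hornerE /= /z /diag0 /diag1 /up0 /up1 /low2 /diag0.
  by field; rewrite B0 t0' k0 two0 oner_eq0.
- rewrite defectE ?invr_eq0 //; apply: contraNneq u0 => E0.
  have := congr1 (fun M : 'M_2 => M 0 0) E0; rewrite !mxE /= => /eqP.
  have -> : diag0 B B^-1 + diag1 k (- k) B B^-1 * z =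
      (B - B^-1) * ((B + B^-1) ^+ 2 + 4) / (2 * (B + B^-1)).
    by rewrite /z /diag0 /diag1; field; rewrite ?B0 ?t0' ?k0 ?two0 ?oner_eq0.
  rewrite !mulf_eq0 invr_eq0 (negPf s0) mulf_eq0 (negPf two0) (negPf t0).
  by rewrite !orbF.
Qed.

End Family.

(** * Elements of infinite order in characteristic zero *)

Section InfiniteOrder.
Variable K : fieldType.
Hypothesis K_char0 : [pchar K] =i pred0.

Lemma natr_char0 n : (n%:R == 0 :> K) = (n == 0)%N.
Proof. by move/pcharf0P: K_char0. Qed.

Lemma intr_char0 i : (i%:~R == 0 :> K) = (i == 0).
Proof.
case: i => n; first exact: natr_char0.
by rewrite NegzE mulrNz oppr_eq0 natr_char0.
Qed.

Definition inf_order (b : K) := b != 0 /\ forall i : int, i != 0 -> b ^ i != 1.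

Lemma inf_order2 : inf_order 2.
Proof.
split=> [|i]; first by rewrite natr_char0.
have pow2 n : (2 : K) ^+ n.+1 != 1.
  rewrite -natrX -subr_eq0 -(natrB _ (expn_gt0 2 n.+1)) natr_char0.
  by rewrite subn_eq0 -ltnNge -{1}(expn0 2) ltn_exp2l.
by case: i => [[|n]|n] // _; rewrite /exprz ?invr_eq1 pow2.
Qed.

Lemma inf_order_sqr b : inf_order b -> inf_order (b ^+ 2).
Proof.
case=> b0 bi; split=> [|i i0]; first by rewrite expf_neq0.
by rewrite -[b ^+ 2]/(b ^ 2%:Z) exprz_exp bi // mulf_neq0.
Qed.

Lemma inf_order_subV b i : inf_order b -> i != 0 -> b ^ i - (b ^ i)^-1 != 0.
Proof.
case=> b0 bi i0; rewrite subV_eq0 ?expfz_neq0 //.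
by rewrite exprnP exprz_exp bi // mulf_neq0.
Qed.

Lemma inf_order_addV b i : inf_order b -> i != 0 -> b ^ i + (b ^ i)^-1 != 0.
Proof.
move=> ob i0; have := inf_order_subV (inf_order_sqr ob) i0.
have b0 : b ^ i != 0 by case: ob => b0 _; rewrite expfz_neq0.
rewrite -[b ^+ 2]/(b ^ 2%:Z) exprzAC -exprnP; apply: contraNneq => E.
have -> : (b ^ i) ^+ 2 - ((b ^ i) ^+ 2)^-1
          = (b ^ i + (b ^ i)^-1) * (b ^ i - (b ^ i)^-1) by field.
by rewrite E mul0r.
Qed.

Lemma diag0_inf_order b l n :
  inf_order b -> l != n -> diag0 (b ^ l) (b ^ n) != 0.
Proof.
move=> ob ln; have b0 : b != 0 by case: ob.
rewrite /diag0; have := @inf_order_subV b (l - n) ob.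
by rewrite subr_eq0 expfzDr // -invr_expz invf_div; apply.
Qed.

End InfiniteOrder.

(** * Choice of the parameters *)

Section Exponents.
Variable K : closedFieldType.
Hypothesis K_char0 : [pchar K] =i pred0.
Variables k l m n : int.
Hypotheses (k0 : k != 0) (l0 : l != 0) (m0 : m != 0) (n0 : n != 0).
Hypothesis (ln : l != n).

Local Notation kK := (k%:~R : K).
Local Notation mK := (m%:~R : K).
Local Notation f b := (defect_poly kK mK (b ^ l) (b ^ n)).
Local Notation generic_at b := (generic kK mK (b ^ l) (b ^ n)).

Let kK0 : kK != 0. Proof. by rewrite intr_char0. Qed.
Let mK0 : mK != 0. Proof. by rewrite intr_char0. Qed.

Lemma size_defect_poly (b : K) : inf_order b -> (1 < size (f b))%N.
Proof.
move=> ob; have b0 : b != 0 by case: ob.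
by rewrite defect_poly_nonconst ?diag0_inf_order ?inf_order_subV ?expfz_neq0.
Qed.

Lemma defect_poly_root (b : K) : inf_order b ->
  exists2 z, z != 0 & (f b).[z] = 0.
Proof.
move=> ob; have : size (f b) != 1%N by rewrite neq_ltn size_defect_poly ?orbT.
case/closed_rootP => z /rootP fz; exists z => //.
apply: contraNneq (diag0_inf_order ob ln) => z0; move/eqP: fz.
by rewrite z0 /defect_poly !hornerE /= oppr_eq0 expf_eq0.
Qed.

Lemma exprz_sqr (b : K) i : (b ^+ 2) ^ i = (b ^ i) ^+ 2.
Proof. by rewrite -[b ^+ 2]/(b ^ 2%:Z) exprzAC -exprnP. Qed.

(** With s(x) = x - 1/x, t(x) = x + 1/x, P = B N and Q = B/N, failure of
    genericity at b reads (m - k) s(P) + (m + k) s(Q) = 0.  Since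
    s(x^2) = s(x) t(x), failure at b^2 gives a second linear relation, and the
    two are independent because t(P) - t(Q) = s(B) s(N) does not vanish.  So
    (m + k) s(Q) = (m - k) s(P) = 0. *)
Lemma not_generic_exponents (b : K) : inf_order b ->
  ~~ generic_at b -> ~~ generic_at (b ^+ 2) -> m = - k /\ n = - l.
Proof.
move=> ob; have b0 : b != 0 by case: ob.
have [Bl0 Bn0] : b ^ l != 0 /\ b ^ n != 0 by rewrite !expfz_neq0.
have sl := inf_order_subV ob l0; have sn := inf_order_subV ob n0.
rewrite /generic !exprz_sqr => /negPn; rewrite -subr_eq0 => /eqP g1 /negPn.
rewrite -subr_eq0 => /eqP g2.
have mk : m = - k.
  apply/eqP; rewrite -subr_eq0 opprK -(intr_char0 K_char0) intrD.
  have : (mK + kK) * diag0 (b ^ l) (b ^ n)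
         * (b ^ l - (b ^ l)^-1) * (b ^ n - (b ^ n)^-1) = 0.
    rewrite /diag0 -[RHS](subr0 0).
    rewrite -{1}(mulr0 (b ^ l * b ^ n + (b ^ l * b ^ n)^-1)) -{1}g1 -g2.
    by field; rewrite Bl0 Bn0.
  move/eqP; rewrite !mulf_eq0 (negPf sl) (negPf sn).
  by rewrite (negPf (diag0_inf_order ob ln)) !orbF.
split=> //; apply/eqP; rewrite -subr_eq0 opprK; apply: contraTT isT => nl.
have := inf_order_subV ob nl; rewrite expfzDr //.
have : (mK - kK) * (b ^ n * b ^ l - (b ^ n * b ^ l)^-1)
       * (b ^ l - (b ^ l)^-1) * (b ^ n - (b ^ n)^-1) = 0.
  rewrite -[RHS](subr0 0) -{2}(mulr0 (b ^ l / b ^ n + b ^ n / b ^ l)).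
  by rewrite -{2}g1 -{1}g2; field; rewrite Bl0 Bn0.
move/eqP; rewrite !mulf_eq0 (negPf sl) (negPf sn) !orbF => /orP[|->//].
have -> : mK - kK = - (2 * kK) by rewrite mk mulrNz; ring.
by rewrite oppr_eq0 mulf_eq0 natr_char0 // (negPf kK0).
Qed.

Lemma unipotent_parameters : exists b z : K,
  [/\ inf_order b, z != 0, (f b).[z] = 0
    & defect z kK mK (b ^ l) (b ^ n) != 0].
Proof.
have ob := inf_order2 K_char0; move: (2 : K) ob => b ob.
have ob2 := inf_order_sqr ob.
set goal := (ex _).
have gen (c : K) : inf_order c -> generic_at c -> goal.
  move=> oc gc; have [z z0 fz] := defect_poly_root oc.
  have c0 : c != 0 by case: oc.
  by exists c, z; split=> //; apply: defect_generic; rewrite ?expfz_neq0.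
have [|g1] := boolP (generic_at b); first exact: gen.
have [|g2] := boolP (generic_at (b ^+ 2)); first exact: gen.
have [mk nl] := not_generic_exponents ob g1 g2.
have two0 : 2 != 0 :> K by rewrite natr_char0.
have special (c : K) : inf_order c ->
    (c ^ l + (c ^ l)^-1) ^+ 2 + 4 != 0 -> goal.
  move=> oc uc; have c0 : c != 0 by case: oc.
  have [z0 fz Ez] := defect_special kK0 (expfz_neq0 l c0) two0
    (inf_order_subV oc l0) (inf_order_addV oc l0) uc.
  exists c; eexists; rewrite mk nl mulrNz -invr_expz.
  by split; [exact: oc | exact: z0 | exact: fz | exact: Ez].
have [u1|] := eqVneq ((b ^ l + (b ^ l)^-1) ^+ 2 + 4) 0; last exact: special.
(* If B + 1/B has square -4, then B^2 + 1/B^2 = -6, and 36 + 4 <> 0. *)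
apply: (special _ ob2); rewrite exprz_sqr.
have -> : ((b ^ l) ^+ 2 + ((b ^ l) ^+ 2)^-1) ^+ 2 + 4
   = ((b ^ l + (b ^ l)^-1) ^+ 2 + 4) * ((b ^ l + (b ^ l)^-1) ^+ 2 - 8) + 40.
  by field; case: ob => b0 _; rewrite expfz_neq0.
by rewrite u1 mul0r add0r natr_char0.
Qed.

(** * Values of the double commutator *)

Local Notation scal b :=
  (kK * mK * (b ^ l - (b ^ l)^-1) * (b ^ n - (b ^ n)^-1)).

Lemma scal_neq0 b : inf_order b -> scal b != 0.
Proof. by move=> ob; rewrite !mulf_neq0 ?inf_order_subV. Qed.

Lemma dcomm_family (b z : K) : inf_order b -> exists g h : SL2 K,
  \tr (val (dcomm k l m n g h)) = 2 - scal b ^+ 2 * (z ^+ 4 * (f b).[z])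
  /\ (z != 0 -> defect z kK mK (b ^ l) (b ^ n) != 0 ->
      dcomm k l m n g h != 1%g).
Proof.
move=> ob; have b0 : b != 0 by case: ob.
have [Bl0 Bn0] : b ^ l != 0 /\ b ^ n != 0 by rewrite !expfz_neq0.
have det_upper : \det (upper (1 : K)) == 1.
  by rewrite mx2_det; apply/eqP; ring.
have det_lower : \det (lower z b) == 1 by rewrite mx2_det mul0r subr0 mulfV.
pose g : SL2 K := MkSL2 det_upper; have gE : val g = upper 1 by [].
pose h : SL2 K := MkSL2 det_lower; have hE : val h = lower z b by [].
exists g, h; rewrite /dcomm.
set A := [~ expgz g k, expgz h l]%g; set B := [~ expgz g m, expgz h n]%g.
have br : val A *m val B - val B *m val A = scal b *:
    (mx2 z (-1) 0 (-z) *m defect z kK mK (b ^ l) (b ^ n)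
     *m mx2 z (-1) 0 (-z)).
  by rewrite !(commUL_expgz _ _ b0 gE hE) commUL_bracket.
split=> [|z0].
  rewrite tr_SL2_commutator br detZ !det_mulmx mx2_det defect_det //.
  by congr (_ - _); ring.
apply: contraNneq => /eqP /commgP /(congr1 val) AB.
have Zu : mx2 z (-1) 0 (-z) \in unitmx.
  by rewrite unitmxE mx2_det mulr0 subr0 mulrN unitfE oppr_eq0 mulf_neq0.
move/eqP: br; rewrite [val A *m _]AB subrr eq_sym.
rewrite scaler_eq0 (negPf (scal_neq0 ob)) /= => /eqP E0; apply/eqP.
by rewrite -[LHS](mulKmx Zu) -[X in _ *m X](mulmxK Zu) E0 mul0mx mulmx0.
Qed.

Lemma dcomm_trace (t : K) :
  exists g h : SL2 K, \tr (val (dcomm k l m n g h)) = t.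
Proof.
have ob := inf_order2 K_char0; move: (2 : K) ob => b ob.
have : size (scal b ^+ 2 *: (f b * 'X^4) + (t - 2)%:P) != 1%N.
  have f0 : f b != 0 by rewrite -size_poly_gt0 ltnW ?size_defect_poly.
  have sz : size (scal b ^+ 2 *: (f b * 'X^4)) = (4 + size (f b))%N.
    by rewrite size_scale ?expf_neq0 ?scal_neq0 // size_mulXn.
  by rewrite size_polyDl sz ?(leq_ltn_trans (size_polyC_leq1 _)) // addSn.
case/closed_rootP => z.
rewrite rootE hornerD hornerZ hornerM hornerXn hornerC => /eqP fz.
have [g [h [tr_w _]]] := dcomm_family z ob.
exists g, h; rewrite tr_w [z ^+ 4 * _]mulrC.
by apply/eqP; rewrite -subr_eq0 -oppr_eq0 -fz; apply/eqP; ring.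
Qed.

Lemma dcomm_unipotent : exists g h : SL2 K,
  \tr (val (dcomm k l m n g h)) = 2 /\ dcomm k l m n g h != 1%g.
Proof.
have [b [z [ob z0 fz E0]]] := unipotent_parameters.
have [g [h [tr_w w1]]] := dcomm_family z ob.
by exists g, h; rewrite tr_w fz !mulr0 subr0; split; rewrite ?w1.
Qed.

Lemma tr2_nonscalar (A : SL2 K) : \tr A = 2 -> A != 1%g -> ~~ is_scalar_mx A.
Proof.
move=> trA; apply: contra_neqN => /is_scalar_mxP[x Ax]; apply: val_inj => /=.
have : 2 * (x - 1) = 0.
  by rewrite mulrBr mulr1 -{2}trA Ax mxtrace_scalar mulr_natl subrr.
by move/eqP; rewrite mulf_eq0 natr_char0 //= subr_eq0 Ax => /eqP->.
Qed.

(** Trace -2 is left out because a value with this trace would have to be told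
    apart from - 1; up to sign, trace 2 covers it. *)
Lemma dcomm_SL2_onto (A : SL2 K) : \tr A != - 2 ->
  exists g h : SL2 K, dcomm k l m n g h = A.
Proof.
move=> trA_N2.
have conj_onto (g h : SL2 K) : ~~ is_scalar_mx (dcomm k l m n g h) ->
    ~~ is_scalar_mx A -> \tr (dcomm k l m n g h) = \tr A ->
    exists g h : SL2 K, dcomm k l m n g h = A.
  move=> nsw nsA /(SL2_conj nsw nsA)[C wC].
  by exists (g ^ C)%g, (h ^ C)%g; rewrite dcomm_conj.
have [->|A1] := eqVneq A 1%g.
  exists 1%g, 1%g; rewrite /dcomm.
  have expgz1 i : expgz (1%g : SL2 K) i = 1%g.
    by case: i => j; rewrite /expgz expg1n ?invg1.
  by rewrite !expgz1 !commg1.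
have [trA2|trA_2] := eqVneq (\tr A) 2.
  have [g [h [tr_w w1]]] := dcomm_unipotent.
  by apply: (conj_onto g h); rewrite ?tr2_nonscalar // trA2.
have nonscal (B : SL2 K) : \tr B = \tr A -> ~~ is_scalar_mx B.
  move=> trB; apply/negP => /scalar_SL2_tr; rewrite trB.
  by case=> /eqP; [apply/negP | apply/negP].
have [g [h tr_w]] := dcomm_trace (\tr A).
by apply: (conj_onto g h) => //; apply: nonscal.
Qed.

HB.instance Definition _ :=
  Multiplicative_isUMagmaMorphism.Build (SL2 K) (PSL2 K) \pi_(PSL2 K)%qT erefl.

Lemma dcomm_PSL2_onto (x : PSL2 K) :
  exists g h : PSL2 K, dcomm k l m n g h = x.
Proof.
have [A [trA <-]] : exists A : SL2 K, \tr A != - 2 /\ \pi_(PSL2 K)%qT A = x.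
  have [trx|] := eqVneq (\tr (repr x)) (- 2); last first.
    by exists (repr x); rewrite reprK.
  have detN : \det (- (repr x : 'M[K]_2)) == 1.
    by rewrite -scaleN1r detZ SL2_det mulr1 sqrrN expr1n.
  exists (MkSL2 detN); split.
    rewrite /= raddfN [X in - X]trx opprK.
    by rewrite -subr_eq0 opprK -natrD natr_char0.
  rewrite -[RHS]reprK; apply: PSL2_pi; rewrite /PSL2_eq /=.
  by rewrite eqxx orbT.
have [g [h <-]] := dcomm_SL2_onto trA.
by exists (\pi_(PSL2 K)%qT g), (\pi_(PSL2 K)%qT h); rewrite dcomm_morph.
Qed.

End Exponents.

Theorem theorem1 (K : closedFieldType) (K_char0 : [pchar K]%R =i pred0)
    (k l m n : int) (w_neq1 : double_commutator k l m n != 1%g) :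
  forall z : PSL2 K, exists gh : PSL2 K * PSL2 K,
    word_map (double_commutator k l m n) gh = z.
Proof.
move=> x; case/dcomm_neq1: w_neq1 => k0 l0 m0 n0 kmln.
suff [g [h <-]] : exists g h : PSL2 K, dcomm k l m n g h = x.
  by exists (g, h); rewrite word_map_dcomm.
have [ln|ln] := eqVneq l n; last exact: dcomm_PSL2_onto.
have {kmln} km : k != m by rewrite ln eqxx orbF in kmln.
have [g [h gh]] := dcomm_PSL2_onto K_char0 l0 k0 n0 m0 km x.
have [y swap] := dcomm_swap k l m n h g.
by exists (h ^ y^-1)%g, (g ^ y^-1)%g; rewrite dcomm_conj swap gh conjgK.
Qed.
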